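(* Let $p\ge 3$ and $n\geq 3p+2$. There is no $n$-dimensional naturally graded complex Zinbiel algebra of type $II$ with characteristic sequence equal to $(n-p,p)$.
   Context: All algebras are finite-dimensional over $\mathbb{C}$. A Zinbiel algebra is an algebra $A$ with multiplication $\circ$ satisfying $(x\circ y)\circ z=x\circ(y\circ z)+x\circ(z\circ y)$ for all $x,y,z$. Put $A^1=A$, $A^{k+1}=A\circ A^k$. (Finite-dimensional complex Zinbiel algebras are nilpotent.) If $s$ is minimal with $A^s=0$, put $A_i=A^i/A^{i+1}$ and $\operatorname{gr}A=A_1\oplus\cdots\oplus A_{s-1}$ with the induced graded multiplication; $A$ is naturally graded if $A\cong\operatorname{gr}A$. For $x\in A\setminus A^2$ let $L_x(y)=x\circ y$ and let $C(x)$ be the descending sequence of sizes of the Jordan blocks of the operator $L_x$. The characteristic sequence is $C(A)=\max_{x\in A\setminus A^2}C(x)$ in the lexicographic order. If $C(A)=(n-p,p)$, $n\geq 2p$, there is a basis of $A$ with first element $e_1\in A\setminus A^2$ in which the matrix of $L_{e_1}$ is block diagonal with (nilpotent) Jordan blocks either $(J_{n-p},J_p)$ or $(J_p,J_{n-p})$ in this order. $A$ is of type $I$ if the form is $(J_{n-p},J_p)$; otherwise it is of type $II$, so that there is a basis $\{e_1,\dots,e_p,f_1,\dots,f_{n-p}\}$ with $e_1\circ e_i=e_{i+1}$ $(1\le i\le p-1)$, $e_1\circ e_p=0$, $e_1\circ f_i=f_{i+1}$ $(1\le i\le n-p-1)$, $e_1\circ f_{n-p}=0$. *)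

(* Defs.v *)
From HB Require Import structures.
From mathcomp Require Import all_boot all_order all_algebra.
From mathcomp Require Export complex.
From mathcomp Require Export reals.

Set Implicit Arguments.
Unset Strict Implicit.
Unset Printing Implicit Defensive.

Import Order.TTheory GRing.Theory.
Local Open Scope ring_scope.
Local Open Scope quotient_scope.

Section QuotientSpace.
Variables (F : fieldType) (V : vectType F) (U : {vspace V}).

Definition vquot := Quotient.quot U.

HB.instance Definition _ := GRing.Zmodule.on vquot.
HB.instance Definition _ := ZmodQuotient.on vquot.

Definition vquot_scale (a : F) : vquot -> vquot := lift_op1 vquot ( *:%R a).

Lemma pi_vquot_scale a : {morph \pi_vquot : x / a *: x >-> vquot_scale a x}.
Proof.
move=> x; unlock vquot_scale; apply/eqP; rewrite -Quotient.idealrBE -scalerBr.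
by rewrite memvZ // Quotient.idealrBE reprK.
Qed.

Lemma vquot_scaleA a b v :
  vquot_scale a (vquot_scale b v) = vquot_scale (a * b) v.
Proof. by rewrite -[v]reprK -!pi_vquot_scale scalerA. Qed.

Lemma vquot_scale1 : left_id 1 vquot_scale.
Proof. by move=> v; rewrite -[v]reprK -pi_vquot_scale scale1r. Qed.

Lemma vquot_scaleDr : right_distributive vquot_scale +%R.
Proof.
move=> a u v; rewrite -[u]reprK -[v]reprK -!raddfD -!pi_vquot_scale -raddfD.
by rewrite scalerDr.
Qed.

Lemma vquot_scaleDl v : {morph vquot_scale^~ v : a b / a + b}.
Proof.
move=> a b /=; rewrite -[v]reprK -!pi_vquot_scale -raddfD.
by rewrite scalerDl.
Qed.

HB.instance Definition _ := GRing.Zmodule_isLmodule.Build F vquot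
  vquot_scaleA vquot_scale1 vquot_scaleDr vquot_scaleDl.

Definition vpi (x : V) : vquot := \pi_vquot x.

Lemma vpi_is_linear : linear vpi.
Proof.
move=> a x y; rewrite /vpi raddfD; congr (_ + _); exact: pi_vquot_scale.
Qed.

HB.instance Definition _ := GRing.isLinear.Build F V vquot _ vpi vpi_is_linear.

Lemma vpi_repr (v : vquot) : vpi (repr v) = v.
Proof. exact: reprK. Qed.

Lemma vpi_eq x y : (vpi x == vpi y) = (x - y \in U).
Proof. by rewrite Quotient.idealrBE. Qed.

End QuotientSpace.

Section DirectSum.
Variables (F : fieldType) (I : finType) (M : I -> lmodType F).

Definition dsum := {dffun forall i, M i}.

HB.instance Definition _ := Choice.on dsum.

Definition dsum0 : dsum := [ffun=> 0].
Definition dsum_opp (x : dsum) : dsum := [ffun i => - x i].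
Definition dsum_add (x y : dsum) : dsum := [ffun i => x i + y i].
Definition dsum_scale (a : F) (x : dsum) : dsum := [ffun i => a *: x i].

Lemma dsum_addA : associative dsum_add.
Proof. by move=> x y z; apply/ffunP => i; rewrite !ffunE addrA. Qed.
Lemma dsum_addC : commutative dsum_add.
Proof. by move=> x y; apply/ffunP => i; rewrite !ffunE addrC. Qed.
Lemma dsum_add0 : left_id dsum0 dsum_add.
Proof. by move=> x; apply/ffunP => i; rewrite !ffunE add0r. Qed.
Lemma dsum_addN : left_inverse dsum0 dsum_opp dsum_add.
Proof. by move=> x; apply/ffunP => i; rewrite !ffunE addNr. Qed.

HB.instance Definition _ :=
  GRing.isZmodule.Build dsum dsum_addA dsum_addC dsum_add0 dsum_addN.

Lemma dsum_scaleA a b x :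
  dsum_scale a (dsum_scale b x) = dsum_scale (a * b) x.
Proof. by apply/ffunP => i; rewrite !ffunE scalerA. Qed.
Lemma dsum_scale1 : left_id 1 dsum_scale.
Proof. by move=> x; apply/ffunP => i; rewrite !ffunE scale1r. Qed.
Lemma dsum_scaleDr : right_distributive dsum_scale +%R.
Proof. by move=> a x y; apply/ffunP => i; rewrite !ffunE scalerDr. Qed.
Lemma dsum_scaleDl x : {morph dsum_scale^~ x : a b / a + b}.
Proof. by move=> a b; apply/ffunP => i; rewrite !ffunE scalerDl. Qed.

HB.instance Definition _ := GRing.Zmodule_isLmodule.Build F dsum
  dsum_scaleA dsum_scale1 dsum_scaleDr dsum_scaleDl.

End DirectSum.

Section ZinbielAlgebras.
Variables (F : fieldType) (A : vectType F) (mul : {bilinear A -> A -> A}).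

Local Notation "x ∘ y" := (mul x y) (at level 40, left associativity).

Definition zinbiel : Prop :=
  forall x y z, (x ∘ y) ∘ z = x ∘ (y ∘ z) + x ∘ (z ∘ y).

(* The span of all products u ∘ v with u in U and v in V. *)
Definition prod_space (U V : {vspace A}) : {vspace A} :=
  <<[seq u ∘ v | u <- vbasis U, v <- vbasis V]>>%VS.

Lemma mem_prod_space (U V : {vspace A}) u v :
  u \in U -> v \in V -> u ∘ v \in prod_space U V.
Proof.
move=> /coord_vbasis -> /coord_vbasis ->.
rewrite linear_sumlz; apply: memv_suml => i _; rewrite linearZl_LR memvZ //.
rewrite linear_sumr; apply: memv_suml => j _; rewrite linearZr_LR memvZ //.
by apply: memv_span; apply: allpairs_f; rewrite mem_nth // size_tuple.
Qed.

Lemma prod_space_subP (U V W : {vspace A}) :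
  (forall u v, u \in U -> v \in V -> u ∘ v \in W) -> (prod_space U V <= W)%VS.
Proof.
move=> UVW; apply/span_subvP => _ /allpairsP[[u v] /= [uU vV ->]].
by apply: UVW; apply: vbasis_mem.
Qed.

(* A^k for k >= 1; the value at k = 0 is never used. *)
Definition zpow (k : nat) : {vspace A} := iter k.-1 (prod_space fullv) fullv.

Lemma zpow_mul (i j : nat) x y : zinbiel ->
  x \in zpow i.+1 -> y \in zpow j.+1 -> x ∘ y \in zpow (i + j).+2.
Proof.
move=> zA; elim: i j x y => [|i IHi] j x y xA yA.
  exact: mem_prod_space (memvf x) yA.
rewrite -[mul x y]/(applyr mul y x).
have /subvP : (zpow i.+2 <= linfun (applyr mul y) @^-1: zpow (i.+1 + j).+2)%VS.
  apply: prod_space_subP => u v _ vA; rewrite -memv_preim lfunE /= zA.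
  have prodA w : w \in zpow (i + j).+2 -> u ∘ w \in zpow (i.+1 + j).+2.
    exact: mem_prod_space (memvf u).
  apply: rpredD; apply: prodA; first exact: IHi.
  suff: forall k w z, w \in zpow k.+1 -> z \in zpow i.+1 ->
          w ∘ z \in zpow (k + i).+2.
    by move/(_ j y v yA vA); rewrite addnC.
  elim=> [|k IHk] w z wA zAi; first exact: mem_prod_space (memvf w) zAi.
  have /subvP : (zpow k.+2 <= linfun (applyr mul z) @^-1: zpow (k.+1 + i).+2)%VS.
    apply: prod_space_subP => u' v' _ vA'; rewrite -memv_preim lfunE /= zA.
    apply: rpredD; apply: mem_prod_space (memvf u') _; first exact: IHk.
    by have := IHi k z v' zAi vA'; rewrite addnC.
  by move/(_ w wA); rewrite -memv_preim lfunE.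
by move/(_ x xA); rewrite -memv_preim lfunE.
Qed.

Definition nilindex (s : nat) : Prop :=
  [/\ (0 < s)%N, zpow s = 0%VS
    & forall k, (0 < k < s)%N -> zpow k <> 0%VS].

(* Graded pieces are numbered from 0: gr_piece k is A_(k+1), the quotient of
   A^(k+1), seen as a space in its own right, by its subspace A^(k+2). *)
Definition gr_piece (k : nat) :=
  vquot (linfun (@vsval F A (zpow k.+1)) @^-1: zpow k.+2)%VS.

Definition gr (s : nat) := dsum (fun i : 'I_s.-1 => gr_piece i : lmodType F).

Definition gr_class (k : nat) (x : A) : gr_piece k :=
  vpi _ (vsproj (zpow k.+1) x).

Definition gr_piece_mul (i j k : nat) (a : gr_piece i) (b : gr_piece j) :
    gr_piece k :=
  gr_class k (vsval (repr a) ∘ vsval (repr b)).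

(* vsproj and repr do not matter: the product is the one induced by ∘. *)
Lemma gr_piece_mulE (i j : nat) x y : zinbiel ->
  x \in zpow i.+1 -> y \in zpow j.+1 ->
  gr_piece_mul (i + j).+1 (gr_class i x) (gr_class j y)
    = gr_class (i + j).+1 (x ∘ y).
Proof.
move=> zA xA yA.
have repr_class k z : z \in zpow k.+1 ->
    z - vsval (repr (gr_class k z)) \in zpow k.+2.
  move=> zk; have := eqxx (gr_class k z).
  rewrite -{2}[gr_class k z]vpi_repr /gr_class vpi_eq -memv_preim lfunE /=.
  by rewrite vsprojK.
set x' := vsval (repr (gr_class i x)); set y' := vsval (repr (gr_class j y)).
have x'A : x' \in zpow i.+1 by apply: subvsP.
have y'A : y' \in zpow j.+1 by apply: subvsP.
apply/eqP; rewrite vpi_eq -memv_preim lfunE /=.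
rewrite !vsprojK; do ?by apply: zpow_mul.
have -> : x' ∘ y' - x ∘ y = - ((x - x') ∘ y) - x' ∘ (y - y').
  by rewrite linearBl linearBr opprB opprB [RHS]addrC addrA subrK.
apply: rpredB; first rewrite rpredN.
  by apply: (@zpow_mul i.+1 j) => //; apply: repr_class.
by rewrite -addnS; apply: zpow_mul => //; apply: repr_class.
Qed.

(* A_(i+1) times A_(j+1) lands in A_(i+j+2), and in 0 when i+j+2 >= s. *)
Definition gr_mul (s : nat) (x y : gr s) : gr s :=
  [ffun k : 'I_s.-1 => \sum_(i < s.-1) \sum_(j < s.-1 | (i + j).+1 == k :> nat)
                         gr_piece_mul k (x i) (y j) : gr_piece k].

Definition naturally_graded : Prop :=
  exists2 s, nilindex s &
    exists2 phi : {linear A -> gr s}, bijective phi &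
      forall x y, phi (x ∘ y) = gr_mul (phi x) (phi y).

(* The block b = (b_0, ..., b_(m-1)) of a basis carries one Jordan block:
   f b_i = lam b_i + b_(i+1), and f b_(m-1) = lam b_(m-1) as b`_m = 0. *)
Definition jordan_block (f : A -> A) (lam : F) (b : seq A) : Prop :=
  forall i, (i < size b)%N -> f b`_i = lam *: b`_i + b`_i.+1.

Definition jordan_sizes (f : A -> A) (c : seq nat) : Prop :=
  [/\ sorted geq c, (0 \notin c)%N &
    exists bs : seq (seq A),
      [/\ shape bs = c, basis_of fullv (flatten bs) &
          forall b, b \in bs -> exists lam, jordan_block f lam b]].

Definition char_seq (c : seq nat) : Prop :=
  (exists2 x, x \notin zpow 2 & jordan_sizes (mul x) c) /\
  (forall x c', x \notin zpow 2 -> jordan_sizes (mul x) c' ->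
     ((c' : seqlexi nat) <= c)%O).

(* Some basis with first element e1 outside A^2 puts L_(e1) in the block
   diagonal form with nilpotent Jordan blocks of sizes c, in this order. *)
Definition adapted_form (c : seq nat) : Prop :=
  exists bs : seq (seq A),
    let e1 := head 0 (flatten bs) in
    [/\ shape bs = c, basis_of fullv (flatten bs), e1 \notin zpow 2 &
        forall b, b \in bs -> jordan_block (mul e1) 0 b].

(* To be read for algebras with characteristic sequence (dim A - p, p), whose
   adapted forms have sizes (dim A - p, p) or (p, dim A - p). An algebra that
   has adapted bases of both forms is of type I. *)
Definition type_I (p : nat) : Prop := adapted_form [:: (\dim {:A} - p)%N; p].

Definition type_II (p : nat) : Prop := ~ type_I p.

End ZinbielAlgebras.

(* Main.v *)
From HB Require Import structures.
Require Import Defs.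
From mathcomp Require Import all_boot all_order all_algebra.
Set Implicit Arguments.
Unset Strict Implicit.
Unset Printing Implicit Defensive.
Import GRing.Theory Num.Theory.
Local Open Scope ring_scope.
Local Open Scope complex_scope.

(** The theorem amounts to the following: a naturally graded Zinbiel algebra
    whose characteristic sequence is (N, p) with N >= 2p + 2 has an adapted
    basis of type I, with N = n - p.

    Let x realise the characteristic sequence.  Two Jordan blocks and
    nilpotency give L_x rank n - 2.  If A^2 were larger than x ∘ A, it would have
    codimension 1, so that x would generate A, but then A^2 = x ∘ A
    ([one_generator_limg]).  So A^2 = x ∘ A, of codimension 2.  Let e be the
    component of x in degree one.  Then e = x - x ∘ a for some a, whence
    e ∘ y = x ∘ (y - a ∘ y - y ∘ a) and e ∘ A = x ∘ A = A^2
    ([limg_lmul_shift]).  The gain is that L_e is homogeneous.  With f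
    completing e to a basis of the degree one part, every homogeneous component
    of A is spanned by e_i = L_e^i (e) and f_i = L_e^i (f)
    ([gen_chains_span]).

    Let q be the first index at which e_q and f_q are dependent.  If e_q is not
    zero, then f_q = c e_q, and e and f - c e head the two strings of a Jordan
    basis for L_e ([chains_basis]).  The longer one starts at e and has length
    M >= N because A^N is not zero; maximality of the characteristic sequence
    forces M = N, and the basis is of type I.

    Suppose e_q = 0 instead, so that the string of f is the long one.  For
    degree reasons f ∘ e = alpha e_1 + beta f_1.  The Zinbiel identity yields,
    modulo e_(j+k+1),
        k! e_k ∘ f_j = (beta + j + 1) ... (beta + j + k) f_(j+k+1)
    ([power_mul_chain]).  At k = q the left-hand side is zero.  Here
    q <= p, so f_(2q+1) is not zero as 2q + 1 < N.  Then j = 0 puts beta in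
    {-1, ..., -q} while j = q puts it in {-q - 1, ..., -2q}: a contradiction ([short_chain_bound]). *)

(** * Internal gradings of naturally graded algebras *)

Section Gradings.
Variables (F : fieldType) (A : vectType F) (mul : {bilinear A -> A -> A}).
Local Notation "x ∘ y" := (mul x y) (at level 40, left associativity).

(** A grading of A given by its projections, which spares casts between the
    components.  The projection [pi i] is onto the component of degree i + 1,
    so that the degrees of factors add up to (i + j).+1. *)
Record grading (pi : nat -> 'End(A)) (m : nat) : Prop := Grading {
  grading_sum : forall z, z = \sum_(i < m) pi i z;
  grading_orth : forall i j z, pi i (pi j z) = if i == j then pi j z else 0;
  grading_mul : forall i j x y, pi (i + j).+1 (pi i x ∘ pi j y) = pi i x ∘ pi j y;
  grading_zpow2 : forall i z, pi i.+1 z \in zpow mul 2 }.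

Section FromGr.
Variable s : nat.
Local Notation grA := (gr mul s).

(** The class of u in A_(k+1), seen in gr A.  The index i, rather than k, is the
    one fed to [gr_class], so that no cast is needed; for k >= s - 1 the value
    is 0, which is the right one as the class of u then lives in a zero space. *)
Definition homog (k : nat) (u : A) : grA :=
  [ffun i : 'I_s.-1 => (if (i : nat) == k then gr_class mul i u else 0)
     : gr_piece mul i].

Definition component (k : nat) (x : grA) : grA :=
  [ffun i : 'I_s.-1 => (if (i : nat) == k then x i else 0) : gr_piece mul i].

Lemma gr_class_linear k : linear (gr_class mul k).
Proof. by move=> a u v; rewrite /gr_class !linearP. Qed.

Lemma gr_class0 k : gr_class mul k 0 = 0.
Proof. by rewrite /gr_class !linear0. Qed.

Lemma homog_linear k : linear (homog k).
Proof.
move=> a u v; apply/ffunP => i; rewrite !ffunE.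
by case: eqP => _; rewrite ?gr_class_linear // scaler0 addr0.
Qed.

Lemma component_linear k : linear (component k).
Proof.
move=> a x y; apply/ffunP => i; rewrite !ffunE.
by case: eqP => _ //; rewrite scaler0 addr0.
Qed.

Lemma component_homog k l u :
  component k (homog l u) = if k == l then homog l u else 0.
Proof.
apply/ffunP => i; rewrite !ffunE; case: (eqVneq k l) => [->|kl] /=.
  by rewrite !ffunE; case: eqP.
rewrite ffunE; case: (eqVneq (i : nat) k) => // ->.
by rewrite (negbTE kl).
Qed.

(** Homogeneous elements of gr A are all of the form [homog k u] with u in
    A^(k+1), and on these the product is simply that of A ([homog_mul]). *)
Lemma component_lift k (x : grA) :
  exists2 u, u \in zpow mul k.+1 & component k x = homog k u.
Proof.
case: (ltnP k s.-1) => ks; last first.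
  exists 0; first exact: mem0v.
  apply/ffunP => i; rewrite !ffunE gr_class0 if_same.
  by rewrite (ltn_eqF (leq_trans (ltn_ord i) ks)).
exists (vsval (repr (x (Ordinal ks)))); first exact: subvsP.
apply/ffunP => i; rewrite !ffunE; case: eqP => // ik.
have -> : i = Ordinal ks by apply: val_inj.
by rewrite /gr_class vsvalK vpi_repr.
Qed.

Lemma sum_component (x : grA) : x = \sum_(k < s.-1) component k x.
Proof.
apply/ffunP => i.
have ev (y z : grA) : (y + z) i = y i + z i by rewrite ffunE.
have ev0 : (0 : grA) i = 0 by rewrite ffunE.
rewrite (big_morph (fun y : grA => y i) ev ev0) (bigD1 i) //= ffunE eqxx.
rewrite big1 ?addr0 // => j ji; rewrite ffunE; case: eqP => // /val_inj ij.
by rewrite ij eqxx in ji.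
Qed.

Hypothesis zA : zinbiel mul.

Lemma gr_piece_mul0l i j (b : gr_piece mul j) :
  gr_piece_mul (i + j).+1 (0 : gr_piece mul i) b = 0.
Proof.
have -> : b = gr_class mul j (vsval (repr b)).
  by rewrite /gr_class vsvalK vpi_repr.
rewrite -(gr_class0 i) gr_piece_mulE ?mem0v ?subvsP //.
by rewrite linear0l gr_class0.
Qed.

Lemma gr_piece_mul0r i j (a : gr_piece mul i) :
  gr_piece_mul (i + j).+1 a (0 : gr_piece mul j) = 0.
Proof.
have -> : a = gr_class mul i (vsval (repr a)).
  by rewrite /gr_class vsvalK vpi_repr.
rewrite -(gr_class0 j) gr_piece_mulE ?mem0v ?subvsP //.
by rewrite linear0r gr_class0.
Qed.

Lemma homog_mul i j u v : u \in zpow mul i.+1 -> v \in zpow mul j.+1 ->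
  gr_mul (homog i u) (homog j v) = homog (i + j).+1 (u ∘ v).
Proof.
move=> ui vj; apply/ffunP => k; rewrite !ffunE.
have term (i' j' k' : 'I_s.-1) : (i' + j').+1 = k' :> nat ->
    gr_piece_mul k' (homog i u i') (homog j v j') =
      if (i' == i :> nat) && (j' == j :> nat) then gr_class mul k' (u ∘ v) else 0.
  rewrite !ffunE => <-.
  case: (eqVneq (i' : nat) i) => [->|_] /=; last exact: gr_piece_mul0l.
  case: (eqVneq (j' : nat) j) => [->|_]; last exact: gr_piece_mul0r.
  exact: gr_piece_mulE.
under eq_bigr => i' _ do under eq_bigr => j' /eqP Ek do rewrite term //.
case: eqP => [kij|kij]; last first.
  rewrite big1 // => i' _; rewrite big1 // => j' /eqP Ek.
  by case: ifP => // /andP[/eqP Ei /eqP Ej]; case: kij; rewrite -Ek Ei Ej.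
have ks := ltn_ord k; rewrite kij in ks.
have is1 : (i < s.-1)%N by apply: leq_trans ks; rewrite ltnS leqW // leq_addr.
have js1 : (j < s.-1)%N by apply: leq_trans ks; rewrite ltnS leqW // leq_addl.
rewrite (bigD1 (Ordinal is1)) //= [X in _ + X]big1 ?addr0; last first.
  move=> i' ne; rewrite big1 // => j' _; case: ifP => // /andP[/eqP Ei _].
  by case/eqP: ne; apply: val_inj.
rewrite (bigD1 (Ordinal js1)) /= ?kij ?eqxx //= big1 ?addr0 //.
move=> j' /andP[_ ne]; case: eqP => // Ej.
by case/eqP: ne; apply: val_inj.
Qed.

End FromGr.

(** The grading of gr A is transported to A.  Positive index components lie in
    A^2 because in gr A they are classes of sums of products. *)
Lemma naturally_graded_grading : zinbiel mul -> naturally_graded mul ->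
  exists pi m, grading pi m.
Proof.
move=> zA [s _ [phi [psi phiK psiK] phiM]].
have psi_lin : linear psi.
  by move=> a x y; apply: (can_inj phiK); rewrite linearP !psiK.
have psiM x y : psi (gr_mul x y) = psi x ∘ psi y.
  by apply: (can_inj phiK); rewrite phiM !psiK.
pose psiL := GRing.isLinear.Build _ _ _ _ psi psi_lin.
pose psi' : {linear gr mul s -> A} := HB.pack psi psiL.
have pi_lin k : linear (fun z => psi (component k (phi z))).
  by move=> a x y; rewrite linearP component_linear psi_lin.
pose piL k := GRing.isLinear.Build _ _ _ _ _ (pi_lin k).
pose pi k : 'End(A) :=
  linfun (HB.pack (fun z => psi (component k (phi z))) (piL k) : {linear A -> A}).
have piE k z : pi k z = psi (component k (phi z)) by rewrite lfunE.
have pi_homog k z : exists2 u, u \in zpow mul k.+1 & pi k z = psi (homog s k u).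
  by have [u uk Ek] := component_lift k (phi z); exists u; rewrite // piE Ek.
have pi_homogE k l u :
    pi k (psi (homog s l u)) = if k == l then psi (homog s l u) else 0.
  by rewrite piE psiK component_homog; case: eqP => // _; exact: (linear0 psi').
exists pi, s.-1; split.
- move=> z; rewrite -{1}[z]phiK {1}[phi z]sum_component.
  rewrite [LHS](linear_sum psi').
  by apply: eq_bigr => i _; rewrite piE.
- by move=> i j z; have [u _ ->] := pi_homog j z; rewrite pi_homogE.
- move=> i j x y; have [u ui ->] := pi_homog i x; have [v vj ->] := pi_homog j y.
  by rewrite -psiM homog_mul // pi_homogE eqxx.
- move=> i z; have [u ui ->] := pi_homog i.+1 z.
  have hL : linear (homog s i.+1) by apply: homog_linear.
  pose h' : {linear A -> gr mul s} :=
    HB.pack (homog s i.+1) (GRing.isLinear.Build _ _ _ _ _ hL).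
  have /subvP : (zpow mul i.+2 <= linfun (psi' \o h') @^-1: zpow mul 2)%VS.
    apply: prod_space_subP => a b _ bi; rewrite -memv_preim lfunE /=.
    rewrite -(@homog_mul s zA 0 i) ?memvf // psiM.
    exact: mem_prod_space (memvf _) (memvf _).
  by move/(_ u ui); rewrite -memv_preim lfunE.
Qed.

End Gradings.

(** * Left multiplications in nilpotent Zinbiel algebras *)

Section Nilpotency.
Variables (F : fieldType) (A : vectType F) (mul : {bilinear A -> A -> A}).
Local Notation "x ∘ y" := (mul x y) (at level 40, left associativity).

Definition lmul (x : A) : 'End(A) := linfun (mul x).

Lemma mem_lmul_limg x y : x ∘ y \in limg (lmul x).
Proof. by rewrite -(lfunE (mul x)) memv_img ?memvf. Qed.

Lemma lmul_limg_sub x : (limg (lmul x) <= zpow mul 2)%VS.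
Proof.
apply/subvP => _ /memv_imgP[y _ ->]; rewrite lfunE.
exact: mem_prod_space (memvf _) (memvf _).
Qed.

Lemma iter_mul_zpow x y k : iter k (mul x) y \in zpow mul k.+1.
Proof.
elim: k => [|k IHk]; first exact: memvf.
exact: mem_prod_space (memvf x) IHk.
Qed.

(** By downward induction on k, a ∘ z lies in x ∘ A for all a in A and z in
    A^(k+1): write a = c x + w with w in A^2; then w ∘ z is a sum of
    (u ∘ v) ∘ z = u ∘ (v ∘ z + z ∘ v), whose right factors are in A^(k+2). *)
Lemma one_generator_limg m x : zinbiel mul -> zpow mul m.+1 = 0%VS ->
  (<[x]> + zpow mul 2)%VS = fullv -> (zpow mul 2 <= limg (lmul x))%VS.
Proof.
move=> zA nilA genA.
suff mulx d k a z : (k + d)%N = m -> z \in zpow mul k.+1 ->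
    a ∘ z \in limg (lmul x).
  by apply: prod_space_subP => a z _ zf; apply: (mulx m 0%N).
elim: d k a z => [|d IHd] k a z kdm zk.
  move: zk; rewrite -[k]addn0 kdm nilA memv0 => /eqP ->.
  by rewrite linear0r mem0v.
have /memv_addP[_ /vlineP[c ->] [w wA ->]] : a \in (<[x]> + zpow mul 2)%VS.
  by rewrite genA memvf.
rewrite linearDl; apply: memvD.
  by rewrite linearZl_LR memvZ // mem_lmul_limg.
rewrite -[mul w z]/(applyr mul z w).
have /subvP : (zpow mul 2 <= linfun (applyr mul z) @^-1: limg (lmul x))%VS.
  apply: prod_space_subP => u v _ _; rewrite -memv_preim lfunE /= zA -linearDr.
  apply: (IHd k.+1); first by rewrite addSnnS.
  apply: memvD; first exact: mem_prod_space (memvf _) zk.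
  by have := @zpow_mul _ _ mul k 0%N z v zA zk (memvf v); rewrite addn0.
by move/(_ w wA); rewrite -memv_preim lfunE.
Qed.

(** L_(x - x ∘ a) = L_x T with T y = y - (a ∘ y + y ∘ a), and T is invertible
    because y = a ∘ y + y ∘ a puts y in every A^k, hence makes it 0. *)
Lemma limg_lmul_shift m x a : zinbiel mul -> zpow mul m.+1 = 0%VS ->
  limg (lmul (x - x ∘ a)) = limg (lmul x).
Proof.
move=> zA nilA; pose T : 'End(A) := \1%VF - linfun (mul a) - linfun (applyr mul a).
have TE y : T y = y - (a ∘ y + y ∘ a).
  by rewrite /T !(add_lfunE, opp_lfunE) id_lfunE !lfunE /= opprD addrA.
have -> : lmul (x - x ∘ a) = (lmul x \o T)%VF.
  apply/lfunP => y; rewrite comp_lfunE TE !lfunE /=.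
  by rewrite linearBl linearBr zA linearDr.
rewrite limg_comp; congr (_ @: _)%VS; apply: lker0_limgf.
rewrite -subv0; apply/subvP => y; rewrite memv_ker TE subr_eq0 => /eqP yE.
rewrite -nilA; elim: {1}m => [|k IHk]; first exact: memvf.
rewrite yE; apply: memvD; first exact: mem_prod_space (memvf _) IHk.
by have := @zpow_mul _ _ mul k 0%N y a zA IHk (memvf a); rewrite addn0.
Qed.

Lemma nil_jordan_block m x lam b : zpow mul m.+1 = 0%VS -> (0 < size b)%N ->
  b`_(size b).-1 != 0 -> jordan_block (mul x) lam b -> lam = 0.
Proof.
move=> nilA b0 bn0 bJ; apply/eqP; apply: contraNT bn0 => lam0.
have step : x ∘ b`_(size b).-1 = lam *: b`_(size b).-1.
  by rewrite bJ ?prednK // [b`_(size b)]nth_default ?addr0.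
have iterE k : iter k (mul x) b`_(size b).-1 = lam ^+ k *: b`_(size b).-1.
  elim: k => [|k IHk]; first by rewrite scale1r.
  by rewrite iterS IHk linearZr_LR /= step scalerA exprSr.
have := iter_mul_zpow x b`_(size b).-1 m.
by rewrite nilA memv0 iterE scaler_eq0 expf_eq0 (negbTE lam0) andbF.
Qed.

Lemma iter_jordan_block (f : A -> A) b k : jordan_block f 0 b ->
  (k < size b)%N -> iter k f b`_0 = b`_k.
Proof.
move=> bJ; elim: k => // k IHk kb.
by rewrite iterS IHk 1?ltnW // bJ ?scale0r ?add0r // ltnW.
Qed.

(** As L_x is nilpotent, its corank is its number of Jordan blocks, and A^N
    contains the last vector of the block of size N. *)
Lemma two_block_corank m x N p : zpow mul m.+1 = 0%VS ->
    jordan_sizes (mul x) [:: N; p] ->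
  [/\ (0 < N)%N, (0 < p)%N, zpow mul N != 0%VS,
     (\dim (limg (lmul x)) + 2)%N = \dim {:A} & \dim {:A} = (N + p)%N].
Proof.
move=> nilA [_ c0 [bs [bsE bsB bsJ]]].
case: bs bsE bsB bsJ => [|v [|u [|? ?]]] //= [vN up] bsB bsJ.
have [N0 p0] : (0 < N)%N /\ (0 < p)%N.
  by move: c0; rewrite !inE negb_or !lt0n ![0%N == _]eq_sym => /andP.
rewrite cats0 in bsB.
have n0 w : w \in v ++ u -> w != 0.
  exact: free_not0 (basis_free bsB).
have nilJ b : b \in [:: v; u] -> jordan_block (mul x) 0 b.
  move=> bvu; have [lam bJ] := bsJ b bvu.
  have b0 : (0 < size b)%N by move: bvu; rewrite !inE => /orP[]/eqP->; rewrite ?vN ?up.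
  suff lam0 : lam = 0 by rewrite -{1}lam0.
  apply: (nil_jordan_block nilA b0) bJ; apply: n0.
  have : b`_(size b).-1 \in b by rewrite mem_nth ?prednK.
  by rewrite mem_cat; move: bvu; rewrite !inE => /orP[]/eqP-> -> //; rewrite orbT.
have vJ : jordan_block (mul x) 0 v by apply: nilJ; rewrite inE eqxx.
have uJ : jordan_block (mul x) 0 u by apply: nilJ; rewrite !inE eqxx orbT.
have sizeA : \dim {:A} = (N + p)%N.
  by rewrite -vN -up -size_cat -(span_basis bsB); apply/eqP; apply: basis_free bsB.
split=> //.
  apply: contraNneq (n0 v`_N.-1 _) => [zN0|]; last first.
    by rewrite mem_cat mem_nth // vN prednK.
  rewrite -memv0 -zN0 -(iter_jordan_block vJ) ?vN ?prednK //.
  by have := iter_mul_zpow x v`_0 N.-1; rewrite prednK.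
apply/eqP; rewrite eqn_leq sizeA; apply/andP; split.
  have limgE : (limg (lmul x) <= <<behead v ++ behead u>>)%VS.
    rewrite -(span_basis bsB) limg_span; apply/span_subvP => _ /mapP[w wvu ->].
    have blk b : jordan_block (mul x) 0 b -> w \in b ->
        {subset behead b <= behead v ++ behead u} ->
        lmul x w \in <<behead v ++ behead u>>%VS.
      move=> bJ /(nthP 0)[i ib <-] sub; rewrite lfunE /= bJ // scale0r add0r -nth_behead.
      case: (ltnP i (size (behead b))) => ib'; last by rewrite nth_default ?mem0v.
      by apply/memv_span/sub; rewrite mem_nth.
    move: wvu; rewrite mem_cat => /orP[wv|wu].
      by apply: (blk v vJ wv) => z zv; rewrite mem_cat zv.
    by apply: (blk u uJ wu) => z zu; rewrite mem_cat zu orbT.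
  apply: (@leq_trans ((N.-1 + p.-1) + 2)).
    rewrite leq_add2r; apply: leq_trans (dimvS limgE) _.
    by apply: leq_trans (dim_span _) _; rewrite size_cat !size_behead vN up.
  case: N N0 {vN c0 sizeA} => // N _; case: p p0 {up} => // p _.
  by rewrite /= addnS addnS !addSn addnS addn0.
have spanA : ({:A} <= limg (lmul x) + (<[v`_0]> + <[u`_0]>))%VS.
  rewrite -{1}(span_basis bsB); apply/span_subvP => w.
  have blk b : jordan_block (mul x) 0 b -> w \in b ->
      w \in (limg (lmul x) + <[b`_0]>)%VS.
    move=> bJ /(nthP 0)[[|i] ib <-].
      by apply: subvP (addvSr _ _) _ _; rewrite memv_line.
    apply: subvP (addvSl _ _) _ _.
    by have := bJ i (ltnW ib); rewrite scale0r add0r => <-; apply: mem_lmul_limg.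
  rewrite mem_cat => /orP[/(blk v vJ)|/(blk u uJ)].
    exact: (subvP (addvS (subvv _) (addvSl _ _))).
  exact: (subvP (addvS (subvv _) (addvSr _ _))).
rewrite -sizeA; apply: leq_trans (dimvS spanA) _.
apply: leq_trans (dimv_add_leqif _ _) _; rewrite leq_add2l.
apply: leq_trans (dimv_add_leqif _ _) _.
by rewrite !dim_vline (leq_add (leq_b1 _) (leq_b1 _)).
Qed.

End Nilpotency.

(** * Homogeneous left multiplications *)

Section GradedChains.
Variables (F : fieldType) (A : vectType F) (mul : {bilinear A -> A -> A}).
Variables (pi : nat -> 'End(A)) (m : nat).
Hypothesis piG : grading mul pi m.
Local Notation "x ∘ y" := (mul x y) (at level 40, left associativity).

Lemma grading_ge i z : (m <= i)%N -> pi i z = 0.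
Proof.
move=> mi; rewrite [z](grading_sum piG) linear_sum /= big1 // => j _.
by rewrite (grading_orth piG) gtn_eqF // (leq_trans _ mi).
Qed.

Lemma grading_mul_comp k i j x y :
  pi k (pi i x ∘ pi j y) = if k == (i + j).+1 then pi i x ∘ pi j y else 0.
Proof. by rewrite -(grading_mul piG i j) (grading_orth piG). Qed.

Lemma zpow_grading k i z : z \in zpow mul k.+1 -> (i < k)%N -> pi i z = 0.
Proof.
move=> zk ik; apply/eqP; rewrite -memv_ker; move: z zk; apply/subvP.
elim: k i ik => // k IHk i ik; apply: prod_space_subP => u v _ vk.
rewrite memv_ker [u](grading_sum piG) [v](grading_sum piG).
rewrite linear_sumlz linear_sum /= big1 // => a _.
rewrite linear_sumr linear_sum /= big1 // => b _.
rewrite grading_mul_comp; case: eqP => // Ei.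
have /(subvP (IHk b _)) : v \in zpow mul k.+1 by [].
rewrite memv_ker => bk; rewrite (eqP (bk _)) ?linear0r //.
by rewrite -ltnS; apply: leq_trans ik; rewrite Ei !ltnS leq_addl.
Qed.

Lemma grading_zpow_eq0 : zpow mul m.+1 = 0%VS.
Proof.
apply/eqP; rewrite -subv0; apply/subvP => z zm; rewrite memv0.
by rewrite [z](grading_sum piG) big1 // => i _; rewrite (zpow_grading zm).
Qed.

Lemma sub_pi0_zpow2 z : z - pi 0%N z \in zpow mul 2.
Proof.
case: m piG => [|m'] G; rewrite {1}[z](grading_sum G).
  by rewrite big_ord0 [z](grading_sum G) big_ord0 linear0 subr0 mem0v.
rewrite big_ord_recl addrC addKr; apply: memv_suml => i _.
exact: grading_zpow2 G _ _.
Qed.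

Variable e : A.
Hypothesis e0 : pi 0%N e = e.

Lemma pi_mul0 y : pi 0%N (e ∘ y) = 0.
Proof.
by apply: (@zpow_grading 1) => //; apply: mem_prod_space (memvf _) (memvf _).
Qed.

Lemma pi_mulS i y : pi i.+1 (e ∘ y) = e ∘ pi i y.
Proof.
case: (ltnP i m) => im; last first.
  rewrite [in RHS]grading_ge // linear0r grading_ge //.
  exact: leq_trans im (leqnSn i).
rewrite {1}[y](grading_sum piG) linear_sumr linear_sum /= (bigD1 (Ordinal im)) //=.
rewrite -{1}e0 grading_mul_comp eqxx e0 big1 ?addr0 // => j ne.
rewrite -{1}e0 grading_mul_comp eqSS add0n; case: eqP => // ij.
by case/eqP: ne; apply: val_inj.
Qed.

Lemma pi_iter i k g : pi 0%N g = g ->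
  pi k (iter i (mul e) g) = if k == i then iter i (mul e) g else 0.
Proof.
move=> g0; elim: i k => [|i IHi] [|k] /=.
- exact: g0.
- by rewrite -g0 (grading_orth piG).
- exact: pi_mul0.
- by rewrite pi_mulS IHi eqSS; case: eqP => // _; rewrite linear0r.
Qed.

Definition chains_span (g h : A) := forall i z, exists a b,
  pi i z = a *: iter i (mul e) g + b *: iter i (mul e) h.

(** A graded Nakayama lemma: elements of index i + 1 in A = <e> + <f> + e ∘ A
    come from e ∘ A, hence are the images by L_e of elements of index i. *)
Lemma gen_chains_span f : pi 0%N f = f ->
  (<[e]> + <[f]> + limg (lmul mul e))%VS = fullv -> chains_span e f.
Proof.
move=> f0 gen.
have dec z : exists a b y, z = a *: e + b *: f + e ∘ y.
  have : z \in (<[e]> + <[f]> + limg (lmul mul e))%VS by rewrite gen memvf.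
  case/memv_addP=> _ /memv_addP[_ /vlineP[a ->] [_ /vlineP[b ->] ->]].
  by case=> _ /memv_imgP[y _ ->] ->; exists a, b, y; rewrite lfunE.
elim=> [|i IHi] z; have [a [b [y ->]]] := dec z.
- by exists a, b; rewrite !linearD !linearZ /= pi_mul0 addr0 e0 f0.
- have [c [d Eyi]] := IHi y; exists c, d.
  have e1 : pi i.+1 e = 0 by rewrite -e0 (grading_orth piG).
  have f1 : pi i.+1 f = 0 by rewrite -f0 (grading_orth piG).
  rewrite !linearD !linearZ /= e1 f1 !scaler0 !add0r pi_mulS Eyi.
  by rewrite linearDr !linearZr_LR.
Qed.

Lemma iter_mul0 i : iter i (mul e) 0 = 0.
Proof. by elim: i => //= i ->; rewrite linear0r. Qed.

Definition chain g k := mkseq (fun i => iter i (mul e) g) k.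

Lemma chain_jordan g k : iter k (mul e) g = 0 ->
  jordan_block (mul e) 0 (chain g k).
Proof.
move=> gk i; rewrite size_mkseq => ik; rewrite scale0r add0r nth_mkseq //.
case: (ltnP i.+1 k) => ik'; first by rewrite nth_mkseq.
have ki : k = i.+1 by apply/eqP; rewrite eqn_leq ik' ik.
by rewrite [RHS]nth_default ?size_mkseq // -iterS -ki.
Qed.

(** As L_e^i (g) and L_e^i (h) have index i, a linear relation splits into
    relations between these two vectors for each i; for q <= i < N only
    L_e^i (g) is left. *)
Lemma chains_basis g h N q : pi 0%N g = g -> pi 0%N h = h ->
    chains_span g h -> (q <= N)%N ->
    iter N (mul e) g = 0 -> iter q (mul e) h = 0 ->
    (forall i, (i < N)%N -> iter i (mul e) g != 0) ->
    (forall i a b, (i < q)%N ->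
       a *: iter i (mul e) g + b *: iter i (mul e) h = 0 -> a = 0 /\ b = 0) ->
  basis_of fullv (chain g N ++ chain h q).
Proof.
move=> g0 h0 ghs qN gN hq gn0 indep.
have iter_ge w i k : iter k (mul e) w = 0 -> (k <= i)%N -> iter i (mul e) w = 0.
  by move=> wk ki; rewrite -(subnK ki) iterD wk iter_mul0.
rewrite basisEfree subvf /= andbC; apply/andP; split.
  suff sp : ({:A} <= <<chain g N ++ chain h q>>)%VS.
    exact: leq_trans (dimvS sp) (dim_span _).
  apply/subvP => z _; rewrite [z](grading_sum piG); apply: memv_suml => i _.
  have [a [b ->]] := ghs i z; apply: memvD; apply: memvZ.
    case: (ltnP i N) => iN; last by rewrite (iter_ge _ _ _ gN) ?mem0v.
    apply: memv_span; rewrite mem_cat; apply/orP; left.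
    by apply/mapP; exists (i : nat); rewrite ?mem_iota.
  case: (ltnP i q) => iq; last by rewrite (iter_ge _ _ _ hq) ?mem0v.
  apply: memv_span; rewrite mem_cat; apply/orP; right.
  by apply/mapP; exists (i : nat); rewrite ?mem_iota.
have sz : size (chain g N ++ chain h q) == (N + q)%N.
  by rewrite size_cat !size_mkseq.
apply: (introT (@freeP _ _ _ (Tuple sz))) => k; rewrite big_split_ord /=.
have -> : \sum_(i < N) k (lshift q i) *: (chain g N ++ chain h q)`_i =
          \sum_(i < N) k (lshift q i) *: iter i (mul e) g.
  by apply: eq_bigr => i _; rewrite nth_cat size_mkseq ltn_ord nth_mkseq ?ltn_ord.
have -> : \sum_(i < q) k (rshift N i) *: (chain g N ++ chain h q)`_(N + i) =
          \sum_(i < q) k (rshift N i) *: iter i (mul e) h.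
  apply: eq_bigr => i _.
  by rewrite nth_cat size_mkseq ltnNge leq_addr /= addKn nth_mkseq ?ltn_ord.
move=> k0.
have comp w n (c : 'I_n -> F) (j : 'I_n) : pi 0%N w = w ->
    pi j (\sum_(i < n) c i *: iter i (mul e) w) = c j *: iter j (mul e) w.
  move=> w0; rewrite linear_sum /= (bigD1 j) //= linearZ /= pi_iter // eqxx.
  rewrite big1 ?addr0 // => i ne; rewrite linearZ /= pi_iter //.
  case: eqP => [ij|_]; last by rewrite scaler0.
  by case/eqP: ne; apply: val_inj.
have comp_ge w n (c : 'I_n -> F) j : pi 0%N w = w -> (n <= j)%N ->
    pi j (\sum_(i < n) c i *: iter i (mul e) w) = 0.
  move=> w0 nj; rewrite linear_sum big1 // => i _; rewrite linearZ /= pi_iter //.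
  by rewrite gtn_eqF ?scaler0 // (leq_trans _ nj).
have short (i : 'I_q) : k (lshift q (widen_ord qN i)) = 0 /\ k (rshift N i) = 0.
  apply: (indep i) => //; have := congr1 (pi i) k0.
  rewrite linear0 linearD /= (comp h q (fun i => k (rshift N i)) i) //.
  by rewrite (comp g N (fun i => k (lshift q i)) (widen_ord qN i)).
move=> i; case: (split_ordP i) => j ->; last by case: (short j).
case: (ltnP j q) => jq.
  by have [<- _] := short (Ordinal jq); congr (k (lshift _ _)); apply: val_inj.
have := congr1 (pi j) k0.
rewrite linear0 linearD /= (comp g N (fun i => k (lshift q i)) j) //.
rewrite comp_ge // addr0 => /eqP; rewrite scaler_eq0 (negbTE (gn0 j _)) // orbF.
by move/eqP.
Qed.

End GradedChains.

(** * Products with the powers of one element *)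

Section ShortChain.
Variables (F : fieldType) (A : vectType F) (mul : {bilinear A -> A -> A}).
Local Notation "x ∘ y" := (mul x y) (at level 40, left associativity).
Hypothesis zA : zinbiel mul.
Variable e : A.
Local Notation ePow i := (iter i (mul e) e).

Lemma iter_mul_gen i : ePow i ∘ e = i.+1%:R *: ePow i.+1.
Proof.
elim: i => [|i IHi]; first by rewrite scale1r.
rewrite [ePow i.+1]iterS zA IHi -!iterS linearZr_LR /= -iterS.
by rewrite -[i.+2%:R]natr1 scalerDl scale1r.
Qed.

Variables (f : A) (al be : F).
Local Notation fPow i := (iter i (mul e) f).
Hypothesis fe : f ∘ e = al *: ePow 1 + be *: fPow 1.

Lemma iter_chain_mul_gen j :
  fPow j ∘ e = al *: ePow j.+1 + (be + j%:R) *: fPow j.+1.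
Proof.
elim: j => [|j IHj]; first by rewrite addr0.
rewrite [fPow j.+1]iterS zA IHj -!iterS linearDr !linearZr_LR /= -!iterS.
by rewrite -[j.+1%:R]natr1 [be + (_ + 1)]addrA [(_ + 1) *: _]scalerDl scale1r addrA.
Qed.

(** The recursion behind the two product formulas below: it trades a power
    of e on the left for the action of y |-> e ∘ y + y ∘ e on the right. *)
Lemma iter_mulS k y : k.+1%:R *: (ePow k.+1 ∘ y) = ePow k ∘ (e ∘ y + y ∘ e).
Proof. by rewrite linearDr -zA iter_mul_gen linearZl_LR. Qed.

Lemma powers_mul k j : exists c, k`!%:R *: (ePow k ∘ ePow j) = c *: ePow ((j + k).+1).
Proof.
elim: k j => [|k IHk] j; first by exists 1; rewrite addn0 fact0 !scale1r.
have [c Ec] := IHk j.+1; exists (j.+2%:R * c).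
rewrite factS mulnC natrM -scalerA iter_mulS iter_mul_gen -iterS.
rewrite -{1}[ePow j.+1]scale1r -scalerDl nat1r linearZr_LR /= scalerA mulrC.
by rewrite -!scalerA Ec addSnnS.
Qed.

(** y |-> e ∘ y + y ∘ e sends f_j to (be + j + 1) f_(j+1), up to a multiple of
    e_(j+1); the k factors come from applying it k times. *)
Lemma power_mul_chain k j : exists c, k`!%:R *: (ePow k ∘ fPow j) =
  (\prod_(i < k) (be + (j + i).+1%:R)) *: fPow ((j + k).+1) + c *: ePow ((j + k).+1).
Proof.
elim: k j => [|k IHk] j.
  by exists 0; rewrite addn0 fact0 big_ord0 scale0r addr0 !scale1r.
have [c Ec] := IHk j.+1; have [d Ed] := powers_mul k j.+1.
exists (al * d + (be + j.+1%:R) * c).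
rewrite factS mulnC natrM -scalerA iter_mulS iter_chain_mul_gen -iterS.
rewrite addrCA -{1}[fPow j.+1]scale1r -scalerDl addrCA nat1r.
rewrite linearDr !linearZr_LR /= scalerDr !scalerA ![_ * al]mulrC.
rewrite ![k`!%:R * _]mulrC -!scalerA Ed Ec addSnnS scalerDr !scalerA.
rewrite addrCA scalerDl big_ord_recl addn0; congr (_ + _).
by congr (_ * _ *: _); apply: eq_bigr => i _; rewrite addSnnS.
Qed.
End ShortChain.

(** If f_(2q+1) were nonzero, [power_mul_chain] with k = q and j = 0 or j = q
    would give be both a value in {-1, ..., -q} and one below -q. *)
Lemma short_chain_bound (F : numFieldType) (A : vectType F)
    (mul : {bilinear A -> A -> A}) (e f : A) (al be : F) (q : nat) :
    zinbiel mul -> mul f e = al *: iter 1 (mul e) e + be *: iter 1 (mul e) f ->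
    iter q (mul e) e = 0 -> iter q.*2.+1 (mul e) f = 0.
Proof.
move=> zA fe eq0; apply/eqP/negPn/negP => fn0.
have iter_ge w i k : iter k (mul e) w = 0 -> (k <= i)%N -> iter i (mul e) w = 0.
  move=> wk ki; rewrite -(subnK ki) iterD wk.
  by elim: (i - k)%N => //= l ->; rewrite linear0r.
have vanish j : (j <= q)%N -> exists2 i, (i < q)%N & be = - (j + i).+1%:R.
  move=> jq; have [c] := power_mul_chain zA fe q j.
  rewrite eq0 linear0l scaler0 (iter_ge e _ _ eq0); last by rewrite leqW // leq_addl.
  rewrite scaler0 addr0 => /esym/eqP; rewrite scaler_eq0 => /orP[|/eqP f0].
    by move/prodf_eq0 => [i _]; rewrite addr_eq0 => /eqP ->; exists i.
  by case/eqP: fn0; apply: (iter_ge _ _ _ f0); rewrite ltnS -addnn leq_add2r.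
have [i iq Ebe] := vanish 0%N (leq0n _); have [i' _] := vanish q (leqnn _).
rewrite Ebe => /oppr_inj/eqP.
rewrite eqr_nat add0n eqSS => /eqP Ei; move: iq.
by rewrite Ei ltnNge leq_addr.
Qed.

(** * Lines and independent pairs of vectors *)

Section LinearAlgebra.
Variables (F : fieldType) (V : vectType F).

Lemma dim_add_line (U : {vspace V}) v : v \notin U -> \dim (<[v]> + U) = (\dim U).+1.
Proof.
move=> vU; rewrite dimv_disjoint_sum ?dim_vline; last first.
  apply/eqP; rewrite -subv0; apply/subvP => w; rewrite memv_cap memv0.
  case/andP=> /vlineP[c ->]; have [->|c0] := eqVneq c 0; first by rewrite scale0r.
  by move=> cv; rewrite -[v](scalerK c0) memvZ in vU.
have [v0|_] := eqVneq v 0; last by rewrite add1n.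
by rewrite v0 mem0v in vU.
Qed.

Lemma free_pairP (u v : V) a b : free [:: v; u] ->
  a *: u + b *: v = 0 -> a = 0 /\ b = 0.
Proof.
rewrite free_cons span_seq1 seq1_free => /andP[vu u0] /eqP.
have [->|b0] := eqVneq b 0.
  by rewrite scale0r addr0 scaler_eq0 (negbTE u0) orbF => /eqP.
rewrite addrC addr_eq0 => /eqP bv; case/negP: vu.
by rewrite -[v](scalerK b0) bv memvZ // rpredN memvZ // memv_line.
Qed.

End LinearAlgebra.

(** * Algebras with a long first Jordan block *)

(** The element e is the degree one component of an x realising the
    characteristic sequence.  The basis of type I starts with e: the inequality
    between N and p excludes that the string of e is the short one. *)
Lemma char_seq_adapted_form (F : numFieldType) (A : vectType F)
    (mul : {bilinear A -> A -> A}) (N p : nat) :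
  zinbiel mul -> naturally_graded mul -> char_seq mul [:: N; p] ->
  (p.*2.+2 <= N)%N -> adapted_form mul [:: N; p].
Proof.
move=> zA ngA [[x xA2 jx] maxC] pN.
have [pi [m G]] := naturally_graded_grading zA ngA.
have nilA := grading_zpow_eq0 G.
have [N0 p0 zN rk dimA] := two_block_corank nilA jx.
have A2E : limg (lmul mul x) = zpow mul 2.
  (* Otherwise A^2 has codimension 1 and x generates A, so A^2 lies in x ∘ A. *)
  apply/eqP; rewrite eqEdim lmul_limg_sub -(leq_add2r 2) rk.
  have := dimvS (subvf (<[x]> + zpow mul 2)%VS).
  rewrite dim_add_line // leq_eqVlt => /orP[/eqP full|]; last by rewrite addn2.
  have genA : (<[x]> + zpow mul 2)%VS = fullv.
    by apply/eqP; rewrite eqEdim subvf dim_add_line // full /=.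
  have := dimvS (one_generator_limg zA nilA genA).
  by rewrite -(leq_add2r 2) rk.
pose e := pi 0%N x.
have e0 : pi 0%N e = e by rewrite (grading_orth G).
have eA2 : e \notin zpow mul 2.
  apply: contra xA2 => eA2; rewrite -[x](subrK e) memvD //.
  exact: sub_pi0_zpow2 G x.
have eE : limg (lmul mul e) = zpow mul 2.
  have := sub_pi0_zpow2 G x; rewrite -A2E => /memv_imgP[a _].
  rewrite lfunE /= -/e => xe; have -> : e = x - mul x a by rewrite -xe subKr.
  exact: limg_lmul_shift zA nilA.
(* <e> + A^2 is a hyperplane since A^2 has codimension 2. *)
have [f fW] : exists f, f \notin (<[e]> + zpow mul 2)%VS.
  have /subvPn[f _ fW] : ~~ (fullv <= <[e]> + zpow mul 2)%VS; last by exists f.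
  apply/negP => /dimvS; rewrite dim_add_line // -rk A2E addn2.
  by rewrite ltnn.
pose f0 := pi 0%N f.
have f00 : pi 0%N f0 = f0 by rewrite (grading_orth G).
have f0W : f0 \notin (<[e]> + zpow mul 2)%VS.
  apply: contra fW => f0W; rewrite -[f](subrK f0) memvD //.
  exact: subvP (addvSr _ _) _ (sub_pi0_zpow2 G f).
have gen : (<[e]> + <[f0]> + limg (lmul mul e))%VS = fullv.
  apply/eqP; rewrite eqEdim subvf eE [(<[e]> + _)%VS]addvC -addvA.
  by rewrite dim_add_line // dim_add_line // -rk A2E addn2 /=.
have span0 := gen_chains_span G e0 f00 gen.
have iter_m w : pi 0%N w = w -> iter m (mul e) w = 0.
  move=> w0; have := pi_iter G e0 m m w0.
  by rewrite eqxx (grading_ge G).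
have iter_ge w i k : iter k (mul e) w = 0 -> (k <= i)%N -> iter i (mul e) w = 0.
  by move=> wk ki; rewrite -(subnK ki) iterD wk iter_mul0.
pose dep i := ~~ free [:: iter i (mul e) f0; iter i (mul e) e].
have ex_dep : exists i, dep i.
  by exists m; rewrite /dep free_cons seq1_free [iter m _ e]iter_m // eqxx andbF.
case: (ex_minnP ex_dep) => q dep_q min_q.
have free_lt i : (i < q)%N -> free [:: iter i (mul e) f0; iter i (mul e) e].
  by move=> iq; apply: contraTT iq => di; rewrite -leqNgt min_q.
have q0 : (0 < q)%N.
  rewrite lt0n; apply: contraL dep_q => /eqP ->; rewrite negbK /= free_cons.
  rewrite span_seq1 seq1_free; apply/andP; split.
    by apply: contra f0W; apply: subvP (addvSl _ _) _.
  by apply: contraNneq eA2 => ->; rewrite mem0v.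
have chains g h : pi 0%N g = g -> pi 0%N h = h -> chains_span mul pi e g h ->
    iter q (mul e) h = 0 ->
    (forall i a b, (i < q)%N ->
       a *: iter i (mul e) g + b *: iter i (mul e) h = 0 -> a = 0 /\ b = 0) ->
    exists2 M, (q <= M)%N & [/\ (N <= M)%N, (M + q)%N = (N + p)%N,
      iter M (mul e) g = 0, (forall i, (i < M)%N -> iter i (mul e) g != 0)
      & basis_of fullv (chain mul e g M ++ chain mul e h q)].
  move=> g0 h0 ghs hq indep.
  have exM : exists i, iter i (mul e) g == 0 by exists m; rewrite iter_m.
  case: (ex_minnP exM) => M /eqP gM minM.
  have gn0 i : (i < M)%N -> iter i (mul e) g != 0.
    by move=> iM; apply: contraTN iM => gi; rewrite -leqNgt minM.
  have qM : (q <= M)%N.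
    rewrite leqNgt; apply/negP => Mq; have [] := indep M 1 0 Mq.
      by rewrite gM scaler0 scale0r addr0.
    by move/eqP; rewrite oner_eq0.
  have B := chains_basis G e0 g0 h0 ghs qM gM hq gn0 indep.
  exists M => //.
  split=> //.
    (* For M < N, both strings have died out at index N - 1, and A^N = 0. *)
    rewrite leqNgt; apply: contra zN => MN; rewrite -subv0; apply/subvP => z.
    rewrite -(prednK N0) => zz; rewrite memv0 [z](grading_sum G) big1 // => i _.
    case: (ltnP i N.-1) => iN; first exact: zpow_grading G _ _ _ zz iN.
    have Mi : (M <= i)%N by apply: leq_trans iN; rewrite -ltnS prednK.
    have [a [b ->]] := ghs i z.
    rewrite (iter_ge _ _ _ gM) // (iter_ge _ _ _ hq) ?(leq_trans qM) //.
    by rewrite !scaler0 addr0.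
  rewrite -dimA -(span_basis B) (eqP (basis_free B)).
  by rewrite size_cat !size_mkseq.
(* If e_q = 0, then f0 heads the long string and N >= 2p + 2 makes it longer
   than [short_chain_bound] permits. *)
have [eq0|eq0] := eqVneq (iter q (mul e) e) 0.
  have [] := chains f0 e => //.
  - by move=> i z; have [a [b ->]] := span0 i z; exists b, a; rewrite addrC.
  - move=> i a b iq; rewrite addrC => /(free_pairP (free_lt i iq))[].
    by [].
  move=> M _ [NM MqE _ fn0 _].
  have [al [be fe]] := span0 1%N (mul f0 e).
  have := grading_mul G 0 0 f0 e; rewrite f00 e0 fe => /esym fe'.
  have /fn0/eqP[] : (q.*2.+1 < M)%N; last exact: short_chain_bound zA fe' eq0.
  have qp : (q <= p)%N by rewrite -(leq_add2l N) -MqE leq_add2r.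
  by apply: leq_trans NM; apply: leq_trans pN; rewrite !ltnS leq_double.
have [c fqE] : exists c, iter q (mul e) f0 = c *: iter q (mul e) e.
  apply/vlineP; move: dep_q; rewrite /dep free_cons span_seq1 seq1_free eq0 andbT.
  by rewrite negbK.
have iterB i : iter i (mul e) (f0 - c *: e) = iter i (mul e) f0 - c *: iter i (mul e) e.
  by elim: i => //= i ->; rewrite linearBr linearZr_LR.
have [] := chains e (f0 - c *: e) => //.
- by rewrite linearB linearZ /= f00 e0.
- move=> i z; have [a [b ->]] := span0 i z; exists (a + b * c), b.
  by rewrite iterB scalerBr scalerDl scalerA addrA addrAC addrK.
- by rewrite iterB fqE subrr.
- move=> i a b iq; rewrite iterB scalerBr scalerA addrCA addrC -scalerBl.
  by case/(free_pairP (free_lt i iq)) => /eqP; rewrite subr_eq0 => /eqP -> ->; rewrite mul0r.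
move=> M qM [NM MqE eM _ B].
have hq : iter q (mul e) (f0 - c *: e) = 0 by rewrite iterB fqE subrr.
have J b : b \in [:: chain mul e e M; chain mul e (f0 - c *: e) q] ->
    jordan_block (mul e) 0 b.
  by rewrite !inE => /orP[]/eqP->; apply: chain_jordan.
have jS : jordan_sizes (mul e) [:: M; q].
  split; first by rewrite /= andbT.
    by rewrite !inE negb_or ![0%N == _]eq_sym -!lt0n q0 (leq_trans q0 qM).
  exists [:: chain mul e e M; chain mul e (f0 - c *: e) q]; split.
  - by rewrite /shape /= !size_mkseq.
  - by rewrite /= cats0.
  - by move=> b /J; exists 0.
have MN : M = N.
  have /andP[MN _] := maxC e _ eA2 jS.
  by apply/eqP; rewrite eqn_leq NM andbT.
have qp : q = p by move/eqP: MqE; rewrite MN eqn_add2l => /eqP.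
exists [:: chain mul e e M; chain mul e (f0 - c *: e) q].
rewrite /= cats0 /shape /= !size_mkseq MN qp.
have headE : head 0 (chain mul e e N ++ chain mul e (f0 - c *: e) p) = e.
  by case: (N) N0.
by rewrite headE; split=> //; rewrite -?MN -?qp.
Qed.

Theorem theorem3p14 (R : realType) (p n : nat) :
  (3 <= p)%N -> (3 * p + 2 <= n)%N ->
  ~ exists (A : vectType R[i]) (mul : {bilinear A -> A -> A}),
      [/\ zinbiel mul, \dim {:A} = n, naturally_graded mul,
          char_seq mul [:: (n - p)%N; p] & type_II mul p].
Proof.
move=> _ pn [A [mul [zA dimA ngA csA]]]; apply.
rewrite /type_I dimA; apply: char_seq_adapted_form => //.
by rewrite ltn_subRL; apply: leq_trans pn; rewrite mulSn mul2n addn2 addnS.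
Qed.
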